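(* Let $n\ge 1$, let $c_1,\dots,c_n\ge 0$ be constants, and let $Q=(q_{ij})_{i,j=1}^n$ be a matrix with non-negative entries and $q_{ii}=0$ for $1\le i\le n$. Let $X_{0-}^1,\dots,X_{0-}^n\ge 0$ be $\mathcal{F}_{0-}$-measurable initial conditions, and let $Z^1,\dots,Z^n$ be $\mathbb{F}$-adapted jump processes with $Z^i_{0-}=0$, each having almost surely finitely many jumps in any bounded interval. Consider the system of equations $$X_t^i=X_{0-}^i+c_it-Z_t^i+L_t^i-\sum_{j\neq i}q_{ij}L_t^j,\qquad L_t^i=\sup_{s\le t}\Big(X_{0-}^i+c_is-Z_s^i-\sum_{j\neq i}q_{ij}L_s^j\Big)_-,\qquad 1\le i\le n. \quad (\ast)$$ Then there exist a unique pair $(X,L)$ and a unique (random, possibly infinite) time $\tau^*$ such that $(X,L)$ is a solution of $(\ast)$ on $[0,\tau^* )$ and such that, if $(\widetilde{X},\widetilde{L})$ is any other strong solution of $(\ast)$ on an interval $[0,\widetilde\tau)$ with the same inputs $X_{0-}^1,\dots,X_{0-}^n$ and $Z^1,\dots,Z^n$ as $(X,L)$, then $\widetilde\tau\le\tau^*$ and $\widetilde{L}_t\ge L_t$ for all $t\in[0,\widetilde\tau)$.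
   Context: Fix a probability space $(\Omega,\mathcal{F},\mathbb{P})$ with a filtration $\mathbb{F}=(\mathcal{F}_t)_{t\ge 0-}$ satisfying the usual hypotheses. The time index set is $\{0-\}\cup[0,\infty)$, where the point $0-$ is prepended before $0$ to allow for jumps at the initial time (the left limit of a process at time $0$ is its value at $0-$); suprema over $s\le t$ include $s=0-$, at which the drift term $c_is$ is $0$. All stochastic processes are càdlàg. A jump process is one that is constant between its jumps (for instance, a compound Poisson process). For $a\in\mathbb{R}$, $(a)_-:=-\min(0,a)$. For $x,y\in\mathbb{R}^n$, $x\ge y$ means $x_i\ge y_i$ for all $1\le i\le n$. Given inputs $X_{0-}^1,\dots,X_{0-}^n$ and $Z^1,\dots,Z^n$, a (strong) solution on $[0,\tau)$ is a pair of processes $X=(X^1,\dots,X^n)$ and $L=(L^1,\dots,L^n)$ which simultaneously satisfy both families of equations in the system at time $0-$ and at all times in the (possibly random) interval $[0,\tau)$. Relations between processes and random times are understood pathwise, almost surely, and uniqueness of $(X,L)$ is as processes on $[0,\tau^* )$. *)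

(* Defs.v *)
From HB Require Import structures.
From mathcomp Require Export all_boot all_order all_algebra.
From mathcomp Require Export all_classical all_reals all_analysis.
From mathcomp Require Export measurable_realfun.
Export Order.TTheory GRing.Theory Num.Theory.
Export numFieldNormedType.Exports.

Set Implicit Arguments.
Unset Strict Implicit.
Unset Printing Implicit Defensive.

Local Open Scope classical_set_scope.
Local Open Scope ring_scope.

(* The index set {0-} U [0, oo): [None] is 0-. *)
Definition time (R : realType) : Type := option {nonneg R}.

Section Time.
Context {R : realType}.

Definition time_le (s t : time R) : bool :=
  match s, t with
  | None, _ => true
  | Some _, None => false
  | Some s', Some t' => s'%:num <= t'%:num
  end.

Definition time_lt (s t : time R) : bool := ~~ time_le t s.

(* Real value of a time, with 0- |-> 0. *)
Definition time_val (t : time R) : R := oapp (fun t' : {nonneg R} => t'%:num) 0 t.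

(* [insub r] is [Some r] if 0 <= r and [None] otherwise: the path is extended
   to negative reals by its value at 0-, which is therefore its left limit
   at 0. *)
Definition real_path (f : time R -> R) (r : R) : R := f (insub r).

Definition cadlag_before (b : \bar R) (f : time R -> R) : Prop :=
  forall t : {nonneg R}, (t%:num%:E < b)%E ->
    real_path f r @[r --> (t%:num)^'+] --> f (Some t) /\
    cvg (real_path f r @[r --> (t%:num)^'-]).

Definition jumps_at (f : time R -> R) (t : {nonneg R}) : Prop :=
  lim (real_path f r @[r --> (t%:num)^'-]) <> f (Some t).

Definition constant_between_jumps (f : time R -> R) : Prop :=
  forall s t : time R, time_le s t ->
    (forall u : {nonneg R}, time_lt s (Some u) -> time_le (Some u) t ->
       ~ jumps_at f u) ->
    f s = f t.

Definition locally_finite_jumps (f : time R -> R) : Prop :=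
  forall b : R, finite_set [set t : {nonneg R} | t%:num <= b /\ jumps_at f t].

Definition neg_part (a : R) : R := - Num.min 0 a.

End Time.

Section Processes.
Context d (T : measurableType d) (R : realType) (P : probability T R).

Definition filtration (F : time R -> set_system T) : Prop :=
  [/\ forall t, sigma_algebra setT (F t),
      forall t, F t `<=` measurable &
      forall s t, time_le s t -> F s `<=` F t].

Definition usual_hypotheses (F : time R -> set_system T) : Prop :=
  P.-negligible `<=` F None /\
  forall t : {nonneg R},
    F (Some t) = \bigcap_(s in [set s : {nonneg R} | t%:num < s%:num]) F (Some s).

Definition measurable_wrt (G : set_system T) (Y : T -> R) : Prop :=
  preimage_set_system setT Y measurable `<=` G.

Definition adapted (F : time R -> set_system T) (Y : time R -> T -> R) : Prop :=
  forall t, measurable_wrt (F t) (Y t).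

Definition jump_process (Y : time R -> T -> R) : Prop :=
  {ae P, forall w, cadlag_before +oo%E (Y ^~ w) /\
                   constant_between_jumps (Y ^~ w)}.

Definition random_time (tau : T -> \bar R) : Prop :=
  measurable_fun setT tau /\ forall w, (0 <= tau w)%E.

(* 0- always belongs to the time domain of a solution on [0, b), even if
   b = 0. *)
Definition in_domain (b : \bar R) (t : time R) : Prop :=
  if t is Some t' then (t'%:num%:E < b)%E else True.

Section System.
Context (F : time R -> set_system T) (n : nat) (c : 'I_n -> R) (Q : 'M[R]_n)
        (x0 : 'I_n -> T -> R) (Z : 'I_n -> time R -> T -> R).

Definition unreflected (L : 'I_n -> time R -> T -> R) (i : 'I_n) (t : time R)
    (w : T) : R :=
  x0 i w + c i * time_val t - Z i t w - \sum_(j < n | j != i) Q i j * L j t w.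

(* The supremum is taken in the extended reals: as [L i t w] is real, the
   second equation also says that the supremum is finite. *)
Definition satisfies_system (X L : 'I_n -> time R -> T -> R) (t : time R)
    (w : T) : Prop :=
  forall i : 'I_n,
    X i t w = x0 i w + c i * time_val t - Z i t w + L i t w
              - \sum_(j < n | j != i) Q i j * L j t w /\
    (L i t w)%:E =
      ereal_sup [set (neg_part (unreflected L i s w))%:E
                | s in [set s | time_le s t]].

(* X and L are total functions of time; apart from adaptedness, nothing is
   required of their values at or after tau. *)
Definition strong_solution (X L : 'I_n -> time R -> T -> R) (tau : T -> \bar R)
    : Prop :=
  [/\ random_time tau,
      forall i, adapted F (X i) /\ adapted F (L i),
      {ae P, forall w, forall i, cadlag_before (tau w) (X i ^~ w) /\
                                 cadlag_before (tau w) (L i ^~ w)},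
      {ae P, forall w, forall i, X i None w = x0 i w} &
      {ae P, forall w, forall t, in_domain (tau w) t ->
                                 satisfies_system X L t w}].

Definition minimal_maximal_solution (X L : 'I_n -> time R -> T -> R)
    (tau : T -> \bar R) : Prop :=
  strong_solution X L tau /\
  forall X' L' tau', strong_solution X' L' tau' ->
    {ae P, forall w, (tau' w <= tau w)%E /\
      forall t : {nonneg R}, (t%:num%:E < tau' w)%E ->
        forall i, L i (Some t) w <= L' i (Some t) w}.

End System.
End Processes.

(* Main.v *)
Require Import Defs.
From mathcomp Require Import all_boot all_order all_algebra.
From mathcomp Require Import all_classical all_reals all_analysis measurable_realfun.
From mathcomp Require Import lra.

(** The second family of equations says that L is a fixed point of the map
    sending l to the running supremum of the deficit of l, where the deficit
    of l at time s is the negative part of [a s - Q l s] and [a] collects the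
    initial condition, the drift and the jumps of Z. As Q is non-negative this
    map is monotone, so its Picard iterates from 0 increase to a limit with
    values in [0, +oo] ([least_fix]). The map commutes with increasing limits,
    hence the limit is again a fixed point ([least_fixE]), and an induction on
    the iterates puts it below every solution, as long as that solution lives
    ([least_fix_le]). The lifetime is the time at which the limit becomes
    infinite: before it the limit is a real solution, and no other solution can
    survive it because it dominates the limit. Maximality and minimality thus
    come together, and uniqueness is the usual comparison of two extremal
    objects ([minimal_maximal_unique]).

    Two points need more than monotonicity, and both rest on the fact that Z
    only moves by isolated jumps. On a time interval free of jumps the forcing
    [a] is non-decreasing, because the drift is non-negative; if l is constant
    there, its deficit is non-increasing, so the running supremum does not move
    either. By induction every iterate, hence the limit, is constant between
    the jumps of Z ([least_fix_quiet]).
    - A limit of an increasing sequence of càdlàg functions need not be càdlàg,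
      but a function that is constant off a set of isolated times is
      ([cadlag_quiet]).
    - A running supremum runs over uncountably many times, but between jumps
      the deficit decreases at most linearly, so the supremum over the rational
      times and the two endpoints is the same ([sup_sample]). The iterates are defined by these
      countable suprema, which makes them adapted at once. *)

Import Order.TTheory GRing.Theory Num.Theory.

Set Implicit Arguments.
Unset Strict Implicit.
Unset Printing Implicit Defensive.

Local Open Scope classical_set_scope.
Local Open Scope ring_scope.

(** * The time line *)

Section TimeOrder.
Context {R : realType}.
Implicit Types s t u : time R.

Lemma time_le_refl t : time_le t t.
Proof. by case: t => //= t; exact: lexx. Qed.

Lemma time_le_trans t s u : time_le s t -> time_le t u -> time_le s u.
Proof. by case: s t u => [s|] [t|] [u|] //=; exact: le_trans. Qed.

Lemma time_le_total s t : time_le s t || time_le t s.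
Proof. by case: s t => [s|] [t|] //=; exact: le_total. Qed.

Lemma time_val_ge0 t : 0 <= time_val t.
Proof. by case: t => [t|] /=. Qed.

Lemma time_val_le s t : time_le s t -> time_val s <= time_val t.
Proof. by case: s t => [s|] [t|] //= _; exact: ge0. Qed.

Lemma time_lt_le s t : time_lt s t -> time_le s t.
Proof.
by rewrite /time_lt => /negbTE st; have := time_le_total s t; rewrite st orbF.
Qed.

Lemma insub_num (t : {nonneg R}) : insub t%:num = Some t :> time R.
Proof. exact: valK. Qed.

Lemma insub_neg (r : R) : r < 0 -> insub r = None :> time R.
Proof.
move=> r0; case: insubP => // t _ tr; exfalso.
have h : 0 <= t%:num := ge0 t.
have e : t%:num = r := tr.
by move: r0; rewrite -e ltNge h.
Qed.

Lemma insub_ge0 (r : R) : 0 <= r ->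
  exists2 t : {nonneg R}, insub r = Some t :> time R & t%:num = r.
Proof.
move=> r0; exists (NngNum r0) => //.
by rewrite -[X in insub X]/((NngNum r0)%:num) insub_num.
Qed.

Lemma insub_homo (r r' : R) : r <= r' -> time_le (insub r) (insub r').
Proof.
have [r0 _|r0 rr'] := ltP r 0; first by rewrite insub_neg.
have [u -> ur] := insub_ge0 r0.
by have [u' -> ur'] := insub_ge0 (le_trans r0 rr'); rewrite /= ur ur'.
Qed.

Lemma time_lt_insub (r : R) (u : {nonneg R}) :
  time_lt (insub r) (Some u) -> r < u%:num.
Proof.
have [r0 _|r0] := ltP r 0; first exact: lt_le_trans r0 _.
by have [v -> <-] := insub_ge0 r0; rewrite /time_lt /= -ltNge.
Qed.

Lemma time_le_insub (r : R) (u : {nonneg R}) :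
  time_le (Some u) (insub r) -> u%:num <= r.
Proof.
have [r0|r0] := ltP r 0; first by rewrite insub_neg.
by have [v -> <-] := insub_ge0 r0.
Qed.

End TimeOrder.

(** * Isolated jump times and countable suprema *)

Section QuietIntervals.
Context {R : realType}.
Implicit Types (J : set {nonneg R}) (g : time R -> \bar R).
Local Open Scope ereal_scope.

(** The interval is open at s and closed at t: a jump at s is already part of
    the value at s of a right-continuous path. *)
Definition quiet J (s t : time R) : Prop :=
  forall u, time_lt s (Some u) -> time_le (Some u) t -> ~ J u.

Lemma quiet_prefix J s t u : time_le u t -> quiet J s t -> quiet J s u.
Proof. by move=> ut q v sv vu; apply: q => //; exact: time_le_trans vu ut. Qed.

Definition isolated_times J : Prop :=
  forall r : R, exists2 e : R, (0 < e)%R &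
    forall u : {nonneg R}, (`|u%:num - r| < e)%R -> u%:num != r -> ~ J u.

Lemma isolated_times_right J : isolated_times J ->
  forall r : R, exists2 e : R, (0 < e)%R &
    forall u : {nonneg R}, (r < u%:num < r + e)%R -> ~ J u.
Proof.
move=> Ji r; have [e e0 He] := Ji r; exists e => // u /andP[ru ue].
by apply: He; [rewrite ltr_norml; apply/andP; split; lra | rewrite gt_eqF].
Qed.

(** The rational times up to t, together with t and 0-: a rational
    beyond t gives t, and a negative rational gives 0-. *)
Definition sample (t : time R) (q : rat) : time R :=
  let s := insub (ratr q : R) in if time_le s t then s else t.

Lemma sample_le t q : time_le (sample t q) t.
Proof. by rewrite /sample; case: ifPn => // _; exact: time_le_refl. Qed.

Definition sup_upto (g : time R -> \bar R) (t : time R) : \bar R :=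
  ereal_sup [set g s | s in [set s | time_le s t]].

Lemma sup_upto_ge g s t : time_le s t -> g s <= sup_upto g t.
Proof. by move=> st; apply: ereal_sup_ubound; exists s. Qed.

Lemma sup_upto_le g t x : (forall s, time_le s t -> g s <= x) ->
  sup_upto g t <= x.
Proof. by move=> h; apply: ge_ereal_sup => _ [s /h hs <-]. Qed.

Lemma sup_upto_homo g s t : time_le s t -> sup_upto g s <= sup_upto g t.
Proof.
move=> st; apply: sup_upto_le => u us.
by apply: sup_upto_ge; exact: time_le_trans us st.
Qed.

(** A time s < t is followed by a quiet interval, in which rational
    times lie arbitrarily close to s; there the values of g fall short of
    [g s] by at most C times the distance to s. *)
Lemma sup_sample (J : set {nonneg R}) (g : time R -> \bar R) (C : R) t :
    isolated_times J -> (0 <= C)%R ->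
    (forall s u, time_le s u -> quiet J s u ->
       g s <= g u + (C * (time_val u - time_val s))%:E) ->
  ereal_sup (range (g \o sample t)) = sup_upto g t.
Proof.
move=> Ji C0 gC; apply/eqP; rewrite eq_le; apply/andP; split.
  apply: ge_ereal_sup => _ [q _ <-] /=; apply: sup_upto_ge; exact: sample_le.
have sg q : g (sample t q) <= ereal_sup (range (g \o sample t)).
  by apply: ereal_sup_ubound; exists q.
have sN : g None <= ereal_sup (range (g \o sample t)).
  have := sg (-1)%R; rewrite /sample insub_neg //.
  by rewrite rmorphN1 ltrN10.
apply: sup_upto_le => -[r|_]; last exact: sN.
case: t sg sN => [t|] // sg _ /= rt.
have [tr|] := boolP (t%:num <= r%:num)%R.
  have -> : r = t by apply/val_inj/eqP; rewrite eq_le rt tr.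
  have tt1 : (t%:num < t%:num + 1)%R by rewrite ltrDl.
  have [q] := rat_in_itvoo tt1; rewrite in_itv /= => /andP[qt1 _].
  have [u qu uq] : exists2 u : {nonneg R}, insub (ratr q : R) = Some u :> time R &
      u%:num = ratr q by apply: insub_ge0; apply: le_trans (ltW qt1).
  by have := sg q; rewrite /sample qu /= ifN // uq -ltNge.
rewrite -ltNge => {}rt; apply/lee_addgt0Pr => eps eps0.
have [e e0 Je] := isolated_times_right Ji r%:num.
(* C may vanish, so the distance to s is bounded by means of C + 1. *)
have C1 : (0 < C + 1)%R by rewrite ltr_wpDl.
pose b : R := Num.min t%:num (Num.min (r%:num + e) (r%:num + eps / (C + 1)))%R.
have rb : (r%:num < b)%R.
  by rewrite /b !lt_min rt !ltrDl e0 divr_gt0.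
have [q] := rat_in_itvoo rb; rewrite in_itv /= => /andP[rq].
rewrite /b !lt_min => /and3P[qt qe qC].
have [u qu uq] : exists2 u : {nonneg R}, insub (ratr q : R) = Some u :> time R &
    u%:num = ratr q by apply: insub_ge0; apply: le_trans (ltW rq).
have := sg q; rewrite /sample qu /= uq (ltW qt) => gq.
suff Ce : (C * (ratr q - r%:num))%:E <= eps%:E.
  apply: le_trans (leeD gq Ce); rewrite -uq.
  apply: (gC (Some r) (Some u)); first by rewrite /= uq ltW.
  move=> v /=; rewrite /time_lt /= -ltNge => rv vu.
  by apply: Je; rewrite rv /=; apply: le_lt_trans qe; rewrite -uq.
rewrite lee_fin; apply: (@le_trans _ _ ((C + 1) * (ratr q - r%:num))%R).
  by rewrite ler_wpM2r ?lerDl// subr_ge0 ltW.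
by rewrite mulrC -ler_pdivlMr// lerBlDl ltW.
Qed.

(** On a quiet interval the supremum is already attained by the
    initial endpoint. *)
Lemma sup_upto_quiet J g s t : (forall u, time_le s u -> quiet J s u -> g u <= g s) ->
  time_le s t -> quiet J s t -> sup_upto g t = sup_upto g s.
Proof.
move=> gJ st q; apply/eqP; rewrite eq_le (sup_upto_homo _ st) andbT.
apply: sup_upto_le => u ut; have [us|] := boolP (time_le u s).
  exact: sup_upto_ge.
move=> /time_lt_le su.
apply: le_trans (sup_upto_ge _ (time_le_refl s)).
by apply: gJ => //; exact: quiet_prefix ut q.
Qed.

End QuietIntervals.

(** * The least fixed point *)

Section Picard.
Context {R : realType} (n : nat) (Q : 'M[R]_n).
Hypothesis Q_ge0 : forall i j, 0 <= Q i j.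
Local Open Scope ereal_scope.

(** The negative part of [a - Q l], written as a maximum so that it makes
    sense for infinite l. *)
Definition deficit (a : 'I_n -> time R -> R) (l : 'I_n -> time R -> \bar R)
    (i : 'I_n) (t : time R) : \bar R :=
  maxe 0 (\sum_(j < n | j != i) (Q i j)%:E * l j t - (a i t)%:E).

Lemma deficit_fin a (l : 'I_n -> time R -> R) i s :
  deficit a (fun j t => (l j t)%:E) i s =
    (neg_part (a i s - \sum_(j < n | j != i) Q i j * l j s)%R)%:E.
Proof.
rewrite /deficit /neg_part; under eq_bigr do rewrite -EFinM.
by rewrite sumEFin -EFinB -EFin_max oppr_min oppr0 opprB.
Qed.

Lemma deficit_ge0 a l i t : 0 <= deficit a l i t.
Proof. by rewrite /deficit le_max lexx. Qed.

Lemma deficit_homo a l l' i t : (forall j, l j t <= l' j t) ->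
  deficit a l i t <= deficit a l' i t.
Proof.
move=> ll'; rewrite /deficit ge_max le_max lexx /= le_max; apply/orP; right.
by rewrite leeD2r// lee_sum// => j _; rewrite lee_wpmul2l// lee_fin.
Qed.

(** The supremum is taken over the samples of [0-, t] so that measurability is
    preserved at each step; [picardS_sup_upto] recovers the full supremum. *)
Fixpoint picard (a : 'I_n -> time R -> R) (k : nat) (i : 'I_n) (t : time R)
    : \bar R :=
  if k is k'.+1 then
    ereal_sup (range (deficit a (picard a k') i \o sample t))
  else 0.

(** The values may be infinite: the blow-up of this process is what ends
    the life of the solution. *)
Definition least_fix (a : 'I_n -> time R -> R) (i : 'I_n) (t : time R)
    : \bar R :=
  ereal_sup (range (fun k => picard a k i t)).

Lemma picard_ge0 a k i t : 0 <= picard a k i t.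
Proof.
case: k => //= k.
by apply: ereal_sup_ge; exists (deficit a (picard a k) i (sample t 0));
  [exists 0%R | exact: deficit_ge0].
Qed.

Lemma picard_homo a i t :
  {homo (fun k => picard a k i t) : k m / (k <= m)%N >-> k <= m}.
Proof.
apply: homo_leq; [exact: lexx | by move=> ? ? ?; exact: le_trans | move=> k].
elim: k i t => [|k IH] i t; first exact: picard_ge0.
apply: ge_ereal_sup => _ [q _ <-] /=; apply: ereal_sup_ge.
exists (deficit a (picard a k.+1) i (sample t q)); first by exists q.
by apply: deficit_homo => j; exact: IH.
Qed.

Lemma picard_le_least_fix a k i t : picard a k i t <= least_fix a i t.
Proof. by apply: ereal_sup_ubound; exists k. Qed.

Lemma least_fix_ge0 a i t : 0 <= least_fix a i t.
Proof. exact: (picard_le_least_fix a 0). Qed.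

(** Induction on the iterates. The supersolution inequality is asked for up to
    time b only, so that a solution with a finite lifetime qualifies. *)
Lemma least_fix_le a (l : 'I_n -> time R -> \bar R) b :
    (forall i s t, time_le s t -> time_le t b -> deficit a l i s <= l i t) ->
  forall i t, time_le t b -> least_fix a i t <= l i t.
Proof.
move=> dl i t tb; apply: ge_ereal_sup => _ [k _ <-].
elim: k i t tb => [|k IH] i t tb /=.
  apply: le_trans (dl i t t (time_le_refl t) tb); exact: deficit_ge0.
apply: ge_ereal_sup => _ [q _ <-] /=.
apply: le_trans (dl i (sample t q) t (sample_le t q) tb).
apply: deficit_homo => j; apply: IH.
exact: time_le_trans (sample_le t q) tb.
Qed.

Section QuietForcing.
Context (J : set {nonneg R}) (C : R) (a : 'I_n -> time R -> R).
Hypothesis J_isolated : isolated_times J.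
Hypothesis C0 : (0 <= C)%R.
Hypothesis aJ : forall i s t, time_le s t -> quiet J s t ->
  (a i s <= a i t <= a i s + C * (time_val t - time_val s))%R.

(** The first bound makes the running supremum constant on quiet intervals;
    the second allows it to be computed on rational times. *)
Lemma deficit_quiet l i s t : time_le s t -> quiet J s t ->
    (forall j, l j s = l j t) ->
  deficit a l i t <= deficit a l i s <=
  deficit a l i t + (C * (time_val t - time_val s))%:E.
Proof.
move=> st q lst; have /andP[h1 h2] := aJ i st q; rewrite /deficit.
under [X in _ <= maxe 0 (X - _) <= _]eq_bigr do rewrite lst.
have d0 : (0 <= C * (time_val t - time_val s))%R.
  by rewrite mulr_ge0// subr_ge0 time_val_le.
set S := \sum_(j < n | _) _; set e := (C * _)%R in d0 h2 *.
case: S => [x||] /=.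
- rewrite -!EFinB -!EFin_max -EFinD !lee_fin; apply/andP; split.
    rewrite ge_max le_max lexx /= le_max; apply/orP; right; lra.
  rewrite ge_max; apply/andP; split.
    by rewrite addr_ge0// le_max lexx.
  apply: (@le_trans _ _ (x - a i t + e)%R); first lra.
  by rewrite lerD2r le_max lexx orbT.
- by rewrite !maxey lexx.
- by rewrite !maxeNy lexx /= add0e lee_fin.
Qed.

Lemma picardS_sup_upto k i t :
    (forall j s u, time_le s u -> quiet J s u ->
       picard a k j s = picard a k j u) ->
  picard a k.+1 i t = sup_upto (deficit a (picard a k) i) t.
Proof.
move=> kJ; apply: (@sup_sample _ J _ C) => // s u su q.
by have /andP[] := deficit_quiet i su q (fun j => kJ j s u su q).
Qed.

Lemma picard_quiet k i s t : time_le s t -> quiet J s t ->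
  picard a k i s = picard a k i t.
Proof.
elim: k i s t => // k IH i s t st q; rewrite !picardS_sup_upto//.
apply/esym/(sup_upto_quiet (J := J)) => // u su qu.
by have /andP[] := deficit_quiet i su qu (fun j => IH j s u su qu).
Qed.

Lemma least_fix_quiet i s t : time_le s t -> quiet J s t ->
  least_fix a i s = least_fix a i t.
Proof.
move=> st q; rewrite /least_fix; congr ereal_sup; apply: eq_imagel => k _.
exact: picard_quiet.
Qed.

(** Continuity of the deficit along the increasing sequence of
    iterates: the finite sums of [Q i j * picard k j s] converge in the
    extended reals. *)
Lemma deficit_least_fix_le i s x :
  (forall k, deficit a (picard a k) i s <= x) -> deficit a (least_fix a) i s <= x.
Proof.
move=> dx; rewrite /deficit ge_max; apply/andP; split.
  apply: le_trans (dx 0%N); exact: deficit_ge0.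
rewrite leeBlDr//.
apply: (@cvge_le _ \oo _ _ (fun k =>
    \sum_(j < n | j != i) (Q i j)%:E * picard a k j s)); last first.
  apply: cvg_nnesum => j _.
    by apply: nearW => k; rewrite mule_ge0// ?lee_fin// picard_ge0.
  by apply: cvgeZl => //; apply: ereal_nondecreasing_cvgn; exact: picard_homo.
apply: nearW => k; rewrite -leeBlDr//.
by apply: le_trans (dx k); rewrite /deficit le_max lexx orbT.
Qed.

(** Suprema over k and over times commute, and the deficit is continuous in
    its argument along the iterates. *)
Lemma least_fixE i t : least_fix a i t = sup_upto (deficit a (least_fix a) i) t.
Proof.
have supE k u : picard a k.+1 i u = sup_upto (deficit a (picard a k) i) u.
  by apply: picardS_sup_upto => j; exact: picard_quiet.
apply/eqP; rewrite eq_le; apply/andP; split.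
  apply: ge_ereal_sup => _ [k _ <-].
  have /le_trans := picard_homo a i t (leqnSn k); apply; rewrite supE.
  apply: sup_upto_le => s st; apply: le_trans (sup_upto_ge _ st).
  by apply: deficit_homo => j; exact: picard_le_least_fix.
apply: sup_upto_le => s st; apply: deficit_least_fix_le => k.
apply: le_trans (picard_le_least_fix a k.+1 i t); rewrite supE.
exact: sup_upto_ge.
Qed.

Lemma least_fix_homo i s t : time_le s t -> least_fix a i s <= least_fix a i t.
Proof. by move=> st; rewrite least_fixE [leRHS]least_fixE; exact: sup_upto_homo. Qed.

End QuietForcing.
End Picard.

(** * Càdlàg paths *)

Section Cadlag.
Context {R : realType}.
Implicit Types (b : \bar R) (f g : time R -> R).

Lemma cadlag_le b b' f : (b <= b')%E -> cadlag_before b' f -> cadlag_before b f.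
Proof. by move=> bb' fc t tb; apply: fc; exact: lt_le_trans bb'. Qed.

Lemma cadlagD b f g : cadlag_before b f -> cadlag_before b g ->
  cadlag_before b (fun t => f t + g t).
Proof.
move=> fc gc t tb; have [fr fl] := fc t tb; have [gr gl] := gc t tb.
by split; [exact: cvgD | exact: is_cvgD].
Qed.

Lemma cadlagZ b k f : cadlag_before b f -> cadlag_before b (fun t => k * f t).
Proof.
move=> fc t tb; have [fr fl] := fc t tb.
by split; [exact: cvgMr | exact: is_cvgMr].
Qed.

Lemma cadlagN b f : cadlag_before b f -> cadlag_before b (fun t => - f t).
Proof.
move=> fc t tb; have [fr fl] := fc t tb.
by split; [exact: cvgN | exact: is_cvgN].
Qed.

Lemma cadlag_cst b k : cadlag_before b (fun=> k).
Proof. by move=> t _; split; [exact: cvg_cst | exact: is_cvg_cst]. Qed.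

Lemma cadlag_sum b (I : Type) (r : seq I) (P : pred I) (f : I -> time R -> R) :
    (forall i, cadlag_before b (f i)) ->
  cadlag_before b (fun t => \sum_(i <- r | P i) f i t).
Proof.
move=> fc; elim: r => [|i r IH].
  by under eq_fun do rewrite big_nil; exact: cadlag_cst.
under eq_fun do rewrite big_cons; case: (P i) => //; exact: cadlagD.
Qed.

Lemma cadlag_time_val b : cadlag_before b (@time_val R).
Proof.
have E r : real_path (@time_val R) r = Num.max r 0.
  rewrite /real_path; have [r0|/insub_ge0[t -> <-]] := ltP r 0.
    by rewrite insub_neg.
  by [].
have C : continuous (real_path (@time_val R)).
  move=> x; rewrite (_ : real_path _ = (fun r => Num.max r 0)); last exact/funext.
  by apply: (@continuous_max _ _ id (cst 0)); [exact: cvg_id | exact: cvg_cst].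
move=> t _; split.
  have -> : time_val (Some t) = real_path (@time_val R) t%:num.
    by rewrite /real_path insub_num.
  by apply: cvg_at_right_filter; exact: C.
apply/cvg_ex; exists (real_path (@time_val R) t%:num).
by apply: cvg_at_left_filter; exact: C.
Qed.

(** Such a function is constant just before and just after every time, and
    just after it the constant is the value at that time. At time 0 the left
    limit is the value at 0-. *)
Lemma cadlag_quiet J b f : isolated_times J ->
    (forall s t, time_le s t -> quiet J s t -> f s = f t) ->
  cadlag_before b f.
Proof.
move=> Ji fJ t _; have [e e0 He] := Ji t%:num.
split.
  apply: cvg_near_cst; near=> r; rewrite /real_path.
  have tr : t%:num < r by near: r; exact: nbhs_right_gt.
  have re : r < t%:num + e by near: r; apply: nbhs_right_lt; rewrite ltrDl.
  have [u -> ur] : exists2 u : {nonneg R}, insub r = Some u :> time R & u%:num = r.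
    by apply: insub_ge0; apply: le_trans (ltW tr).
  apply/esym/fJ => [|v /=]; first by rewrite /= ur ltW.
  rewrite /time_lt /= -ltNge ur => tv vr; apply: He; last by rewrite gt_eqF.
  by rewrite ltr_norml; apply/andP; split; lra.
apply/cvg_ex; exists (real_path f (t%:num - e / 2)).
apply: cvg_near_cst; near=> r.
have rt : r < t%:num by near: r; exact: nbhs_left_lt.
have re : t%:num - e / 2 < r by near: r; apply: nbhs_left_gt; lra.
rewrite /real_path; apply/esym/fJ; first exact: insub_homo (ltW re).
move=> v /time_lt_insub tv /time_le_insub vr; apply: He; last first.
  by rewrite lt_eqF//; exact: le_lt_trans vr rt.
by rewrite ltr_norml; apply/andP; split; lra.
Unshelve. all: by end_near.
Qed.

End Cadlag.

(** * Forcing by drift and jumps *)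

Section Forcing.
Context {R : realType} (n : nat) (c : 'I_n -> R).
Hypothesis c_ge0 : forall i, 0 <= c i.

Definition jump_set (z : 'I_n -> time R -> R) : set {nonneg R} :=
  [set t | exists i, jumps_at (z i) t].

(** Below time [r + 1] there are finitely many jumps; a finite set
    is closed, so r has a neighbourhood containing none of those that differ
    from r. *)
Lemma isolated_jump_set z : (forall i, locally_finite_jumps (z i)) ->
  isolated_times (jump_set z).
Proof.
move=> zf r.
pose A := \bigcup_(i in [set: 'I_n])
  [set t : {nonneg R} | t%:num <= r + 1 /\ jumps_at (z i) t].
have Afin : finite_set A.
  by apply: bigcup_finite; [exact: finite_finset | move=> i _; exact: zf].
have /accessible_finite_set_closed Rclosed := @hausdorff_accessible R (@Rhausdorff R).
pose B := [set t%:num | t in A] `\ r.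
have /Rclosed : finite_set B by apply: finite_setD; exact: finite_image.
rewrite -openC => Bo.
have /Bo/nbhs_ballP[e /= e0 He] : (~` B) r by move=> [_]; exact.
exists (Num.min e 1); first by rewrite lt_min e0 ltr01.
move=> u; rewrite lt_min => /andP[ue u1] ur [i ui].
apply: (He u%:num); first by rewrite /ball /= distrC.
split; last by move/eqP: ur.
exists u => //; exists i => //=; split=> //.
by move: u1; rewrite ltr_norml => /andP[_]; lra.
Qed.

Definition forcing (x : 'I_n -> R) (z : 'I_n -> time R -> R) (i : 'I_n)
  (t : time R) : R := x i + c i * time_val t - z i t.

(** The sum of the drifts serves as a slope common to all
    coordinates. *)
Lemma forcing_quiet x z i s t : constant_between_jumps (z i) ->
    time_le s t -> quiet (jump_set z) s t ->
  forcing x z i s <= forcing x z i t <=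
    forcing x z i s + (\sum_i c i) * (time_val t - time_val s).
Proof.
move=> zc st q.
have zst : z i s = z i t.
  by apply: zc => // u su ut zu; apply: (q u su ut); exists i.
have cs : c i <= \sum_i c i by rewrite (bigD1 i)//= lerDl sumr_ge0.
have st0 : 0 <= time_val t - time_val s by rewrite subr_ge0 time_val_le.
have := ler_wpM2r st0 cs; have := mulr_ge0 (c_ge0 i) st0.
rewrite /forcing zst; set m := _ * (_ - _); set C := \sum_i c i.
rewrite /m mulrBr => ? ?; apply/andP; split; lra.
Qed.

End Forcing.

(** * The explosion time *)

Section ExplosionTime.
Context {R : realType} (n : nat).
Implicit Type l : 'I_n -> time R -> \bar R.
Local Open Scope ereal_scope.

(** The infimum is restricted to rational times to make it measurable; for
    a non-decreasing l this does not change its value. *)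
Definition explosion_time l : \bar R :=
  ereal_inf (range (fun p : 'I_n * rat =>
    let t := insub (ratr p.2 : R) in
    if l p.1 t == +oo then (time_val t)%:E else +oo)).

Lemma explosion_time_ge0 l : 0 <= explosion_time l.
Proof.
apply: le_ereal_inf_tmp => _ [[i q] _ <-] /=.
by case: ifP => _; rewrite ?leey// lee_fin time_val_ge0.
Qed.

Lemma before_explosion l i (t : {nonneg R}) :
    (forall s u, time_le s u -> l i s <= l i u) ->
  t%:num%:E < explosion_time l -> l i (Some t) != +oo.
Proof.
move=> lh; apply: contraTN => /eqP lt; rewrite -leNgt.
apply/lee_addgt0Pr => e e0.
have te : (t%:num < t%:num + e)%R by rewrite ltrDl.
have [q] := rat_in_itvoo te; rewrite in_itv /= => /andP[tq qe].
have [u qu uq] : exists2 u : {nonneg R}, insub (ratr q : R) = Some u :> time R &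
    u%:num = ratr q by apply: insub_ge0; apply: le_trans (ltW tq).
have lu : l i (Some u) = +oo.
  by apply/eqP; rewrite -leye_eq -lt; apply: lh; rewrite /= uq ltW.
apply: (@le_trans _ _ (ratr q)%:E); last by rewrite -EFinD lee_fin ltW.
by apply: ereal_inf_lbound; exists (i, q) => //=; rewrite qu lu eqxx -uq.
Qed.

Lemma le_explosion_time l (b : \bar R) :
    (forall i t, in_domain b t -> l i t != +oo) -> b <= explosion_time l.
Proof.
move=> lb; apply: le_ereal_inf_tmp => _ [[i q] _ <-] /=.
case: ifPn => [lq|_]; last exact: leey.
rewrite leNgt; apply: contraTN lq => tb; apply: lb.
by case: insub tb.
Qed.

End ExplosionTime.

(** * The minimal solution along one path *)

Section Path.
Context {R : realType} (n : nat) (Q : 'M[R]_n).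
Hypothesis Q_ge0 : forall i j, 0 <= Q i j.
Variables (c : 'I_n -> R) (x : 'I_n -> R) (z : 'I_n -> time R -> R).
Hypothesis c_ge0 : forall i, 0 <= c i.
Hypothesis x_ge0 : forall i, 0 <= x i.
Hypothesis z0 : forall i, z i None = 0.
Hypothesis z_const : forall i, constant_between_jumps (z i).
Hypothesis z_jumps : isolated_times (jump_set z).

Let a := forcing c x z.
Let L := least_fix Q a.

Let C_ge0 : 0 <= \sum_i c i. Proof. exact: sumr_ge0. Qed.

Let a_quiet i s t : time_le s t -> quiet (jump_set z) s t ->
  a i s <= a i t <= a i s + (\sum_i c i) * (time_val t - time_val s).
Proof. exact: forcing_quiet. Qed.

Lemma path_least_fix_quiet i s t : time_le s t -> quiet (jump_set z) s t ->
  L i s = L i t.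
Proof.
move=> st q; have := least_fix_quiet Q z_jumps C_ge0 a_quiet i st q.
exact.
Qed.

(** Without initial deficit nothing is pushed at time 0-: the zero
    process is a supersolution up to 0-. *)
Lemma path_least_fix0 i : L i None = 0%E.
Proof.
apply/eqP; rewrite eq_le least_fix_ge0 andbT.
apply: (least_fix_le Q_ge0 (l := fun _ _ => 0%:E) (b := None)) => // {}i.
case=> [s|] [t|] // _ _.
rewrite (deficit_fin Q a (fun _ _ => 0)) lee_fin big1; last by move=> j _; rewrite mulr0.
rewrite subr0 /neg_part /a /forcing z0 /= mulr0 addr0 subr0.
by rewrite oppr_le0 le_min lexx x_ge0.
Qed.

Lemma path_least_fix_fin i t : in_domain (explosion_time L) t ->
  L i t \is a fin_num.
Proof.
rewrite ge0_fin_numE ?least_fix_ge0//; case: t => [t|_]; last by rewrite path_least_fix0 ltry.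
move=> tL; rewrite ltey; apply: before_explosion tL => s u su.
exact: (least_fix_homo Q_ge0 z_jumps C_ge0 a_quiet).
Qed.

(** Before the explosion all values are finite, and the fixed point
    equation becomes the equation of the system for real processes. *)
Lemma path_least_fixE i t : in_domain (explosion_time L) t ->
  (fine (L i t))%:E = sup_upto (fun s =>
    (neg_part (a i s - \sum_(j < n | j != i) Q i j * fine (L j s)))%:E) t.
Proof.
move=> tL; rewrite fineK ?path_least_fix_fin//.
rewrite /L (least_fixE Q_ge0 z_jumps C_ge0 a_quiet) -/L.
congr ereal_sup; apply: eq_imagel => s /= st.
rewrite -(deficit_fin Q a (fun j s => fine (L j s))); apply/eqP; rewrite eq_le.
have sL : in_domain (explosion_time L) s.
  case: s t st tL => [s|] [t|] //= st; apply: le_lt_trans; by rewrite lee_fin.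
by rewrite !deficit_homo// => j; rewrite fineK// path_least_fix_fin.
Qed.

Lemma path_least_fix_le (l : 'I_n -> time R -> R) b :
    (forall i t, in_domain b t -> (l i t)%:E = sup_upto (fun s =>
      (neg_part (a i s - \sum_(j < n | j != i) Q i j * l j s))%:E) t) ->
  forall i t, in_domain b t -> (L i t <= (l i t)%:E)%E.
Proof.
move=> lE i t tb.
apply: (least_fix_le Q_ge0 (l := fun i t => (l i t)%:E) (b := t)); last exact: time_le_refl.
move=> {}i s u su ut; rewrite deficit_fin lE.
  exact: (sup_upto_ge (fun s =>
      (neg_part (a i s - \sum_(j < n | j != i) Q i j * l j s))%:E)).
case: u t ut tb {su} => [u|] [t|] //= ut; apply: le_lt_trans; by rewrite lee_fin.
Qed.

End Path.

(** * Measurability *)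

Section CountableSup.
Context d (T : measurableType d) (R : realType) (I : countType).
Implicit Types f : I -> T -> \bar R.
Local Open Scope ereal_scope.

Lemma measurable_ereal_sup_range f : (forall i, measurable_fun setT (f i)) ->
  measurable_fun setT (fun w => ereal_sup (range (f ^~ w))).
Proof.
(* A code that decodes to no index contributes the neutral value -oo. *)
move=> mf; pose g m w := if unpickle m is Some i then f i w else -oo.
have mg m : measurable_fun setT (g m).
  by rewrite /g; case: (unpickle m) => [i|]; [exact: mf | exact: measurable_cst].
apply: eq_measurable_fun (measurable_fun_esups mg 0) => w _.
apply/eqP; rewrite eq_le; apply/andP; split.
  apply: ge_ereal_sup => _ [m _ <-]; rewrite /g.
  case: (unpickle m) => [i|]; last exact: leNye.
  by apply: ereal_sup_ubound; exists i.
apply: ge_ereal_sup => _ [i _ <-]; apply: ereal_sup_ubound.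
by exists (pickle i) => //; rewrite /g pickleK.
Qed.

Lemma measurable_ereal_inf_range f : (forall i, measurable_fun setT (f i)) ->
  measurable_fun setT (fun w => ereal_inf (range (f ^~ w))).
Proof.
move=> mf; have mNf i : measurable_fun setT (fun w => - f i w).
  exact: measurableT_comp.
have := measurableT_comp (@oppe_measurable R setT) (measurable_ereal_sup_range mNf).
apply: eq_measurable_fun => w _ /=.
by rewrite ereal_infEN; congr (- ereal_sup _); rewrite image_comp.
Qed.

End CountableSup.

Section PicardMeasurable.
Context d (T : measurableType d) (R : realType) (n : nat) (Q : 'M[R]_n).

Lemma measurable_deficit (a : 'I_n -> time R -> T -> R)
    (l : 'I_n -> time R -> T -> \bar R) i t :
    measurable_fun setT (a i t) -> (forall j, measurable_fun setT (l j t)) ->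
  measurable_fun setT (fun w => deficit Q (fun j s => a j s w)
                                  (fun j s => l j s w) i t).
Proof.
move=> ma ml; apply: measurable_maxe; first exact: measurable_cst.
apply: emeasurable_funB; last exact/measurable_EFinP.
under eq_fun do rewrite -big_filter.
by apply: emeasurable_sum => j; exact: measurable_funeM.
Qed.

(** The forcing enters up to time t only, so this applies to the sigma-algebra
    of the events known at time t. *)
Lemma measurable_least_fix (a : 'I_n -> time R -> T -> R) i t :
    (forall j s, time_le s t -> measurable_fun setT (a j s)) ->
  measurable_fun setT (fun w => least_fix Q (fun j s => a j s w) i t).
Proof.
move=> ma; apply: measurable_ereal_sup_range => k.
elim: k i t ma => [|k IH] i t ma; first exact: measurable_cst.
apply: measurable_ereal_sup_range => q /=.
apply: (@measurable_deficit a (fun j s w => picard Q (fun j s => a j s w) k j s)).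
  by apply: ma; exact: sample_le.
move=> j; apply: IH => m s st; apply: ma.
exact: time_le_trans st (sample_le t q).
Qed.

End PicardMeasurable.

Section MeasurableWrt.
Context d (T : measurableType d) (R : realType).
Implicit Types (G : set_system T) (Y : T -> R).

Lemma measurable_wrtP G Y : sigma_algebra setT G ->
  measurable_wrt G Y <->
  measurable_fun setT (Y : g_sigma_algebraType G -> R).
Proof.
move=> sG; split=> mY.
  by move=> _ B mB; apply: sub_sigma_algebra; apply: mY; exists B.
move=> _ [B mB <-]; rewrite -(sigma_algebra_id sG).
exact: (mY measurableT B mB).
Qed.

Lemma measurable_wrt_measurable G Y : G `<=` measurable ->
  measurable_wrt G Y -> measurable_fun setT Y.
Proof. by move=> Gm mY _ B mB; apply: Gm; apply: mY; exists B. Qed.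

Lemma measurable_wrt_sub G G' Y : G `<=` G' -> measurable_wrt G Y ->
  measurable_wrt G' Y.
Proof. by move=> GG' mY B /mY/GG'. Qed.

End MeasurableWrt.

Lemma measurable_explosion_time d (T : measurableType d) (R : realType) n
    (l : 'I_n -> time R -> T -> \bar R) :
    (forall i t, measurable_fun setT (l i t)) ->
  measurable_fun setT (fun w => explosion_time (fun i t => l i t w)).
Proof.
move=> ml; apply: measurable_ereal_inf_range => -[i q] /=.
apply: measurable_fun_ifT; [|exact: measurable_cst..].
by apply: measurable_fun_eqe; [exact: ml | exact: measurable_cst].
Qed.

(** * The reflected process *)

Section Process.
Context d (T : measurableType d) (R : realType) (P : probability T R)
  (F : time R -> set_system T) (n : nat) (c : 'I_n -> R) (Q : 'M[R]_n)
  (x0 : 'I_n -> T -> R) (Z : 'I_n -> time R -> T -> R).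
Hypothesis hF : filtration F.
Hypothesis hc : forall i, 0 <= c i.
Hypothesis hQ : forall i j, 0 <= Q i j.
Hypothesis hx0m : forall i, measurable_wrt (F None) (x0 i).
Hypothesis hx0 : {ae P, forall w, forall i, 0 <= x0 i w}.
Hypothesis hZa : forall i, adapted F (Z i).
Hypothesis hZj : forall i, jump_process P (Z i).
Hypothesis hZ0 : {ae P, forall w, forall i, Z i None w = 0}.
Hypothesis hZf : forall i, {ae P, forall w, locally_finite_jumps (Z i ^~ w)}.

Definition forcing_process i t w : R :=
  forcing c (x0 ^~ w) (fun i => Z i ^~ w) i t.

Definition least_process i t w : \bar R :=
  least_fix Q (fun i t => forcing_process i t w) i t.

(** Almost surely, [fine] meets an infinite argument at or after the lifetime
    only, where the values of L are arbitrary. *)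
Definition reflection i t w : R := fine (least_process i t w).

Definition reflected i t w : R := forcing_process i t w + reflection i t w
  - \sum_(j < n | j != i) Q i j * reflection j t w.

Definition lifetime w : \bar R := explosion_time (fun i t => least_process i t w).

Lemma measurable_wrt_F Y t : measurable_wrt (F t) Y <->
  measurable_fun setT (Y : g_sigma_algebraType (F t) -> R).
Proof. by apply: measurable_wrtP; case: hF. Qed.

Lemma adapted_forcing_process i : adapted F (forcing_process i).
Proof.
move=> t; apply/measurable_wrt_F.
have [_ _ Fsub] := hF.
apply: measurable_funB; last exact/measurable_wrt_F/hZa.
apply: measurable_funD; last exact: measurable_cst.
apply/(@measurable_wrt_F (x0 i) t).
by apply: measurable_wrt_sub (@hx0m i); exact: Fsub.
Qed.

Lemma measurable_wrt_least_process i t :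
  measurable_fun setT (least_process i t : g_sigma_algebraType (F t) -> \bar R).
Proof.
apply: (@measurable_least_fix _ (g_sigma_algebraType (F t)) R n Q forcing_process).
move=> j s st; apply/measurable_wrt_F.
have [_ _ Fsub] := hF.
by apply: measurable_wrt_sub (@adapted_forcing_process j s); exact: Fsub.
Qed.

Lemma adapted_reflection i : adapted F (reflection i).
Proof.
move=> t; apply/measurable_wrt_F.
exact: measurableT_comp (fine_measurable measurableT)
  (@measurable_wrt_least_process i t).
Qed.

Lemma adapted_reflected i : adapted F (reflected i).
Proof.
move=> t; apply/measurable_wrt_F.
apply: measurable_funB.
  apply: measurable_funD; first exact/measurable_wrt_F/adapted_forcing_process.
  exact/measurable_wrt_F/adapted_reflection.
under eq_fun do rewrite -big_filter.
apply: measurable_sum => j; apply: measurable_funM; first exact: measurable_cst.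
exact/measurable_wrt_F/adapted_reflection.
Qed.

Lemma random_lifetime : random_time lifetime.
Proof.
split; last by move=> w; exact: explosion_time_ge0.
apply: measurable_explosion_time => i t.
apply: (@measurable_least_fix _ T R n Q forcing_process) => j s _.
have [_ Fm _] := hF.
exact: measurable_wrt_measurable (Fm s) (@adapted_forcing_process j s).
Qed.

Definition regular_path w : Prop :=
  [/\ forall i, 0 <= x0 i w, forall i, Z i None w = 0,
      forall i, constant_between_jumps (Z i ^~ w),
      isolated_times (jump_set (fun i => Z i ^~ w)) &
      forall i, cadlag_before +oo%E (Z i ^~ w)].

Lemma ae_regular_path : {ae P, forall w, regular_path w}.
Proof.
have hj : {ae P, forall w, forall i, cadlag_before +oo%E (Z i ^~ w) /\
    constant_between_jumps (Z i ^~ w)} by apply: filter_forall => i; exact: hZj.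
have hf : {ae P, forall w, forall i, locally_finite_jumps (Z i ^~ w)}.
  by apply: filter_forall => i; exact: hZf.
apply: filterS (filterI (filterI hx0 hZ0) (filterI hj hf)) => w [[hx hz] [hcc hl]].
split=> //; try by move=> i; case: (hcc i).
exact: isolated_jump_set.
Qed.

Lemma reflection_cadlag w b i : regular_path w -> cadlag_before b (reflection i ^~ w).
Proof.
case=> xw zw cw jw _; apply: (cadlag_quiet jw) => s t st q.
by congr fine; exact: (path_least_fix_quiet Q (x0 ^~ w) hc cw jw).
Qed.

Lemma reflected_cadlag w b i : regular_path w -> cadlag_before b (reflected i ^~ w).
Proof.
move=> rw; have Lc j := @reflection_cadlag w b j rw.
apply: cadlagD; last first.
  by apply: cadlagN; apply: cadlag_sum => j; exact: cadlagZ.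
apply: cadlagD => //; apply: cadlagD.
  apply: cadlagD; first exact: cadlag_cst.
  by apply: cadlagZ; exact: cadlag_time_val.
by apply: cadlagN; case: rw => _ _ _ _ /(_ i); apply: cadlag_le; exact: leey.
Qed.

Lemma strong_solution_reflected :
  strong_solution P F c Q x0 Z reflected reflection lifetime.
Proof.
split.
- exact: random_lifetime.
- by move=> i; split; [exact: adapted_reflected | exact: adapted_reflection].
- apply: filterS ae_regular_path => w rw i.
  by split; [exact: reflected_cadlag | exact: reflection_cadlag].
- apply: filterS ae_regular_path => w [xw zw cw jw _] i.
  rewrite /reflected /reflection /forcing_process /forcing.
  have L0 j : least_process j None w = 0%E by exact: path_least_fix0.
  rewrite L0 big1; last by move=> j _; rewrite L0 mulr0.
  by rewrite zw /= mulr0 !subr0 !addr0.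
- apply: filterS ae_regular_path => w [xw zw cw jw _] t tL i; split=> //.
  exact: (path_least_fixE hQ hc xw zw cw jw).
Qed.

(** Along a path on which the other solution solves the system, it is a
    finite supersolution up to its own lifetime; hence the least fixed point is
    finite there, which gives both claims. *)
Lemma reflection_le X' L' tau' : strong_solution P F c Q x0 Z X' L' tau' ->
  {ae P, forall w, (tau' w <= lifetime w)%E /\
    forall t : {nonneg R}, (t%:num%:E < tau' w)%E ->
      forall i, reflection i (Some t) w <= L' i (Some t) w}.
Proof.
case=> _ _ _ _ hs; apply: filterS (filterI ae_regular_path hs).
move=> w [[xw zw cw jw _] {}hs].
have le := path_least_fix_le hQ (c := c) (x := x0 ^~ w) (z := fun i => Z i ^~ w)
  (l := fun i t => L' i t w) (fun i t tb => proj2 (hs t tb i)).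
split.
  apply: le_explosion_time => i t tb; rewrite -ltey.
  exact: le_lt_trans (le i t tb) (ltry _).
move=> t tb i; rewrite -lee_fin fineK; first exact: le.
rewrite ge0_fin_numE; last exact: least_fix_ge0.
exact: le_lt_trans (le i (Some t) tb) (ltry _).
Qed.

Lemma minimal_maximal_unique X L tau X' L' tau' :
    minimal_maximal_solution P F c Q x0 Z X L tau ->
    minimal_maximal_solution P F c Q x0 Z X' L' tau' ->
  {ae P, forall w, tau' w = tau w /\
    forall t : {nonneg R}, (t%:num%:E < tau w)%E ->
      forall i, X' i (Some t) w = X i (Some t) w /\
                L' i (Some t) w = L i (Some t) w}.
Proof.
move=> [S m] [S' m'].
have [_ _ _ _ hs] := S; have [_ _ _ _ hs'] := S'.
apply: filterS (filterI (filterI (m _ _ _ S') (m' _ _ _ S)) (filterI hs hs')).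
move=> w [[[t1 l1] [t2 l2]] [{}hs {}hs']].
have tt : tau' w = tau w by apply/eqP; rewrite eq_le t1 t2.
split=> // t tw i.
have tw' : (t%:num%:E < tau' w)%E by rewrite tt.
have LL j : L' j (Some t) w = L j (Some t) w.
  by apply/eqP; rewrite eq_le l1// l2.
split=> //; have [-> _] := hs (Some t) tw i; have [-> _] := hs' (Some t) tw' i.
by rewrite LL; congr (_ - _); apply: eq_bigr => j _; rewrite LL.
Qed.

End Process.

Theorem corollary1 (d : measure_display) (T : measurableType d) (R : realType)
    (P : probability T R) (F : time R -> set_system T)
    (hF : filtration F) (hFu : usual_hypotheses P F)
    (n : nat) (hn : (1 <= n)%N)
    (c : 'I_n -> R) (hc : forall i, 0 <= c i)
    (Q : 'M[R]_n) (hQ : forall i j, 0 <= Q i j) (hQd : forall i, Q i i = 0)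
    (x0 : 'I_n -> T -> R)
    (hx0m : forall i, measurable_wrt (F None) (x0 i))
    (hx0 : {ae P, forall w, forall i, 0 <= x0 i w})
    (Z : 'I_n -> time R -> T -> R)
    (hZa : forall i, adapted F (Z i))
    (hZj : forall i, jump_process P (Z i))
    (hZ0 : {ae P, forall w, forall i, Z i None w = 0})
    (hZf : forall i, {ae P, forall w, locally_finite_jumps (Z i ^~ w)}) :
  exists (X L : 'I_n -> time R -> T -> R) (tau : T -> \bar R),
    minimal_maximal_solution P F c Q x0 Z X L tau /\
    forall (X' L' : 'I_n -> time R -> T -> R) (tau' : T -> \bar R),
      minimal_maximal_solution P F c Q x0 Z X' L' tau' ->
      {ae P, forall w, tau' w = tau w /\
        forall t : {nonneg R}, (t%:num%:E < tau w)%E ->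
          forall i, X' i (Some t) w = X i (Some t) w /\
                    L' i (Some t) w = L i (Some t) w}.
Proof.
have mm : minimal_maximal_solution P F c Q x0 Z
    (reflected c Q x0 Z) (reflection c Q x0 Z) (lifetime c Q x0 Z).
  by split; [exact: strong_solution_reflected | exact: reflection_le].
exists (reflected c Q x0 Z), (reflection c Q x0 Z), (lifetime c Q x0 Z).
by split=> // X' L' tau'; exact: minimal_maximal_unique mm.
Qed.
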